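(* Let $f$ be a rule. Then $f$ is non-standard if and only if, for every $P\in\mathcal{L}$, we have $\mathrm{ord}_fP=1\iff P=(1)$.
   Context: Positions are finite tuples $P=(a_1,\dots,a_k)$ of integers with $a_1\geqslant\dots\geqslant a_k\geqslant0$, where tuples differing only by trailing zeros are identified. $(0)$ is the empty position, $\mathcal{L}$ is the set of positions other than $(0)$, and $|P|=\sum a_i$ is the volume of $P$. A chomp move $P\to Q$ from $P=(a_1,\dots,a_k)$ chooses $1\leqslant x\leqslant k$ and an integer $a\geqslant0$, and sets $Q=(b_1,\dots,b_k)$ with $b_j=a_j$ for $j<x$ and $b_j=\min(a_j,a)$ for $j\geqslant x$, where $Q$ must be a different position from $P$. Write $\mathrm{Mov}P=\{Q:P\to Q\}$. An $n$-player rule ($n\geqslant1$) is a tuple $f=(\alpha_1\cdots\alpha_n)$ of distinct reals. Ordinals $\mathrm{ord}_f$ are defined recursively on volume as follows. - $\mathrm{ord}_f(0)=0$. - For a position $Q$, set $s_f(Q)=\alpha_{\mathrm{ord}_fQ+1}$ if $\mathrm{ord}_fQ<n$ and $s_f(Q)=\alpha_1$ if $\mathrm{ord}_fQ=n$. - For $P\in\mathcal{L}$, $\mathrm{ord}_fP$ is the unique $i\in\{1,\dots,n\}$ with $\alpha_i=\max_{Q\in\mathrm{Mov}P}s_f(Q)$. Rules $f,g$ (possibly with different numbers of players) are isomorphic, $f\sim g$, if $\mathrm{ord}_fP=\mathrm{ord}_gP$ for all $P\in\mathcal{L}$. For $k\geqslant1$, let $s_k=(0\,1\,2\cdots k-1)$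 be the $k$-player rule with $\alpha_i=i-1$. A rule $f$ is standard if $f\sim s_k$ for some $k\geqslant1$, and non-standard otherwise. *)

(* Defs.v *)
From HB Require Import structures.
From mathcomp Require Import all_boot all_order all_algebra.
From mathcomp Require Import reals.

Set Implicit Arguments.
Unset Strict Implicit.
Unset Printing Implicit Defensive.

Import Order.TTheory GRing.Theory Num.Theory.
Local Open Scope ring_scope.

(* Tuples differing only by trailing zeros are identified: a position is the  *)
(* representative without zero entries.                                       *)
Record position := Position {
  parts :> seq nat;
  _ : sorted geq parts && (0%N \notin parts)
}.

HB.instance Definition _ := [isSub for parts].
HB.instance Definition _ := [Equality of position by <:].

Definition trim (s : seq nat) : seq nat := [seq y <- s | (0 < y)%N].

Lemma geq_trans : transitive geq.
Proof. by move=> y x z /= yx zy; apply: leq_trans zy yx. Qed.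

Lemma trim_subproof (s : seq nat) :
  sorted geq s -> sorted geq (trim s) && (0%N \notin trim s).
Proof.
move=> ss; rewrite mem_filter ltnn andbT.
exact: sorted_filter geq_trans _ _ ss.
Qed.

Definition pos_of (s : seq nat) (ss : sorted geq s) : position :=
  Position (trim_subproof ss).

Definition pos0 : position := @pos_of [::] isT.
Definition pos1 : position := @pos_of [:: 1%N] isT.

Definition volume (P : position) : nat := sumn P.

(* Rows are numbered from 0 here.                                             *)
Definition chomp_seq (s : seq nat) (x a : nat) : seq nat :=
  take x s ++ [seq minn y a | y <- drop x s].

Lemma chomp_subproof (P : position) (x a : nat) :
  sorted geq (chomp_seq P x a).
Proof.
case: P => s /= /andP[+ _]; rewrite /chomp_seq.
rewrite !(sorted_pairwise geq_trans) -{1}(cat_take_drop x s) !pairwise_cat.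
case/and3P=> /allrelP h1 -> h2 /=; apply/andP; split.
  apply/allrelP => y _ yi /mapP[z zi ->] /=.
  exact: leq_trans (geq_minl _ _) (h1 _ _ yi zi).
rewrite pairwise_map; apply: sub_pairwise h2 => y z /= zy.
by rewrite leq_min geq_minr andbT (leq_trans (geq_minl _ _)).
Qed.

Definition chomp (P : position) (x a : nat) : position :=
  pos_of (chomp_subproof P x a).

Definition move (P Q : position) : Prop :=
  exists x a : nat, [/\ (x < size P)%N, Q = chomp P x a & Q <> P].

(* Cutting at a height >= a_1 does not change P, so a < a_1 suffices.         *)
Definition Mov (P : position) : seq position :=
  [seq Q <- [seq chomp P x a | x <- iota 0 (size P), a <- iota 0 (head 0%N P)]
   | Q != P].

Lemma chomp_id (P : position) (x a : nat) :
  (head 0%N P <= a)%N -> chomp P x a = P.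
Proof.
move=> ha; apply: val_inj => /=.
case: P ha => s /= /andP[ss s0] ha.
have sa y : y \in s -> (y <= a)%N.
  case: s ss {s0} ha => // b s /=; rewrite (path_sortedE geq_trans).
  move=> /andP[/allP hs _] ba; rewrite inE => /predU1P[->//|/hs /= yb].
  exact: leq_trans yb ba.
rewrite /chomp_seq (_ : [seq minn y a | y <- drop x s] = drop x s); last first.
  by rewrite -[RHS]map_id; apply/eq_in_map => y /mem_drop /sa /minn_idPl.
rewrite cat_take_drop; apply/all_filterP/allP => y ys.
by rewrite lt0n; apply: contraNneq s0 => <-.
Qed.

Lemma MovP (P Q : position) : reflect (move P Q) (Q \in Mov P).
Proof.
rewrite mem_filter; apply: (iffP andP).
  case=> /eqP QP /allpairsP[[x a] /= []]; rewrite !mem_iota /= => xP _ QE.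
  by exists x, a.
case=> x [a [xP QE /eqP QP]]; split=> //; apply/allpairsP; exists (x, a).
rewrite !mem_iota /= xP; split=> //; rewrite add0n ltnNge.
by apply: contraNN QP => /(@chomp_id P x) PE; rewrite QE PE.
Qed.

Record rule (R : realType) := Rule {
  payoffs :> seq R;
  _ : (0 < size payoffs)%N && uniq payoffs
}.

Section Ord.
Variables (R : realType) (f : rule R).

(* f`_i is alpha_(i+1); the value s_f(Q) is score (ord Q).                    *)
Definition score (i : nat) : R := if (i < size f)%N then f`_i else f`_0.

Definition is_max (S : seq R) (m : R) : bool :=
  (m \in S) && all (fun y => y <= m) S.

(* The recursion on the volume is driven by m, an upper bound of the volume.  *)
Fixpoint ord_rec (m : nat) (P : position) : nat :=
  if m isn't m'.+1 then 0%N
  else if P == pos0 then 0%N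
  else (find (is_max [seq score (ord_rec m' Q) | Q <- Mov P]) f).+1.

Definition ord (P : position) : nat := ord_rec (volume P) P.

Definition s_ (Q : position) : R := score (ord Q).

End Ord.

Definition isomorphic (R : realType) (f g : rule R) : Prop :=
  forall P : position, P <> pos0 -> ord f P = ord g P.

Lemma std_subproof (R : realType) (k : nat) : (0 < k)%N ->
  (0 < size [seq i%:R : R | i <- iota 0 k])%N
  && uniq [seq i%:R : R | i <- iota 0 k].
Proof.
move=> k0; rewrite size_map size_iota k0 map_inj_uniq ?iota_uniq //.
by move=> i j /eqP; rewrite eqr_nat => /eqP.
Qed.

Definition std_rule (R : realType) (k : nat) (k0 : (0 < k)%N) : rule R :=
  Rule (std_subproof R k0).

Definition standard (R : realType) (f : rule R) : Prop :=
  exists (k : nat) (k0 : (0 < k)%N), isomorphic f (std_rule R k0).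

Section OrdTheory.
Variables (R : realType) (f : rule R).

Lemma ord_pos0 : ord f pos0 = 0%N.
Proof. by []. Qed.

Lemma volume_eq0 (P : position) : (volume P == 0%N) = (P == pos0).
Proof.
apply/eqP/eqP => [|->//]; case: P => -[|b s] sP.
  by move=> _; apply: val_inj.
have /andP[_] := sP; rewrite inE negb_or eq_sym => /andP[b0 _].
by move=> /eqP; rewrite addn_eq0 (negPf b0).
Qed.

Lemma volume_move (P Q : position) : move P Q -> (volume Q < volume P)%N.
Proof.
case=> x [a [_ -> QP]]; rewrite /volume.
have sumn_trim (s : seq nat) : sumn (trim s) = sumn s.
  by elim: s => // -[|y] s /= IH; rewrite IH.
have minE s : (sumn [seq minn y a | y <- s] <= sumn s
                 ?= iff ([seq minn y a | y <- s] == s))%N.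
  elim: s => [|y s IH] /=; first exact/leqif_refl.
  rewrite eqseq_cons; apply: leqif_add => //.
  by split; first exact: geq_minl.
rewrite /= sumn_trim -[in ltnRHS](cat_take_drop x P) /chomp_seq !sumn_cat.
rewrite ltn_add2l (ltn_leqif (minE _)); apply/eqP => E; apply: QP.
apply: val_inj => /=; rewrite /chomp_seq E cat_take_drop.
case: P {E} => s /= /andP[_ s0]; apply/all_filterP/allP => y ys.
by rewrite lt0n; apply: contraNneq s0 => <-.
Qed.

Lemma ord_recE (m : nat) (P : position) :
  (volume P <= m)%N -> ord_rec f m P = ord f P.
Proof.
suff H (k : nat) : forall m1 m2 (Q : position), (volume Q <= k)%N ->
    (volume Q <= m1)%N -> (volume Q <= m2)%N ->
    ord_rec f m1 Q = ord_rec f m2 Q by move=> ?; apply: (H (volume P)).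
elim: k => [|k IH] m1 m2 Q.
  by rewrite leqn0 volume_eq0 => /eqP->; case: m1 m2 => [|?] [|?].
case: (eqVneq Q pos0) => [->|Q0]; first by case: m1 m2 => [|?] [|?].
have v0 : (0 < volume Q)%N by rewrite lt0n volume_eq0.
case: m1 => [|m1] hk h1 h2; first by move: (leq_trans v0 h1).
case: m2 h2 => [|m2] h2; first by move: (leq_trans v0 h2).
rewrite /= (negPf Q0); congr (find (is_max _) _).+1.
apply/eq_in_map => T /MovP /volume_move TQ; congr score.
by apply: IH; rewrite -ltnS; apply: leq_trans TQ _.
Qed.

Lemma ordE (P : position) : P != pos0 ->
  ord f P = (find (is_max [seq s_ f Q | Q <- Mov P]) f).+1.
Proof.
move=> P0; have v0 : (0 < volume P)%N by rewrite lt0n volume_eq0.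
rewrite {1}/ord -(prednK v0) /= (negPf P0); congr (find (is_max _) _).+1.
apply/eq_in_map => Q /MovP /volume_move QP; congr score.
by apply: ord_recE; rewrite -ltnS (prednK v0).
Qed.

Lemma s_mem (Q : position) : s_ f Q \in (f : seq R).
Proof.
rewrite /s_ /score.
have /andP[f0 _] : (0 < size f)%N && uniq f by case: (f).
by case: ifP => ?; apply: mem_nth.
Qed.

Lemma pos0_in_Mov (P : position) : P != pos0 -> pos0 \in Mov P.
Proof.
move=> P0; apply/MovP; exists 0%N, 0%N; split.
- rewrite lt0n; apply: contraNneq P0 => /size0nil P0.
  by apply/eqP/val_inj.
- apply: val_inj; rewrite /= /chomp_seq take0 drop0 /=.
  by elim: (P : seq nat) => //= y s IH; rewrite minn0 /=.
- by move=> P0'; rewrite -P0' eqxx in P0.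
Qed.

Lemma has_is_max (P : position) : P != pos0 ->
  has (is_max [seq s_ f Q | Q <- Mov P]) f.
Proof.
move=> /pos0_in_Mov; case E: (Mov P) => [|Q0 r] // _; rewrite -E.
have : exists2 m, m \in [seq s_ f Q | Q <- Mov P] &
                  all (fun y => y <= m) [seq s_ f Q | Q <- Mov P].
  rewrite E /=; move: (s_ f Q0) (map _ r) => y s.
  elim: s y => [|z s IH] y; first by exists y; rewrite ?inE //= lexx.
  have [m] := IH (Num.max y z); rewrite /= inE => mi /andP[ym ms].
  exists m; last by move: ym; rewrite ge_max ms andbT.
  case/predU1P: mi => [->|ms']; last by rewrite !inE ms' !orbT.
  by case: (leP y z) => _; rewrite !inE eqxx ?orbT.
case=> m mS hm; apply/hasP; exists m; last by rewrite /is_max mS.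
by case/mapP: mS => Q _ ->; apply: s_mem.
Qed.

Lemma ord_bounds (P : position) : P != pos0 -> (0 < ord f P <= size f)%N.
Proof. by move=> P0; rewrite ordE //= -has_find has_is_max. Qed.

Lemma ord_spec (P : position) (i : nat) : P != pos0 ->
  ord f P = i.+1 <->
  [/\ (i < size f)%N, (exists2 Q, move P Q & f`_i = s_ f Q)
    & forall Q, move P Q -> s_ f Q <= f`_i].
Proof.
move=> P0; have hm := has_is_max P0; rewrite ordE //; split.
  case=> <-; rewrite -has_find; split=> //.
    by have /andP[/mapP[Q /MovP]] := nth_find 0 hm; exists Q.
  move=> Q /MovP QP; have /andP[_ /allP] := nth_find 0 hm; apply.
  exact: map_f.
case=> iN [Q /MovP PQ fi] hi; congr S; apply/eqP.
have /andP[_ fu] : (0 < size f)%N && uniq f by case: (f).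
rewrite -(nth_uniq 0 _ iN fu) -?has_find // eq_le.
have /andP[/mapP[T /MovP PT fT] /allP h] := nth_find 0 hm.
by rewrite {1}fT hi //= fi h // map_f.
Qed.

End OrdTheory.

(* Main.v *)
Require Import Defs.
From mathcomp Require Import all_boot all_order all_algebra.
From mathcomp Require Import reals.
From mathcomp Require Import zify.

Set Implicit Arguments.
Unset Strict Implicit.
Unset Printing Implicit Defensive.

Import Order.TTheory GRing.Theory Num.Theory.

(** Let [k >= 1] be the length of the longest increasing prefix of [f].  A
position of ordinal [k] scores [score f k], which is at most [alpha_k].

If [score f k <= alpha_1], this score never beats the one of the empty
position, so [f] is isomorphic to [s_k].  Otherwise [k >= 2] and every row
[(a)] has ordinal [min(a, k)], hence scores more than [alpha_1].  As a position
with at least two rows can be cut down to its first row, it does not have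
ordinal 1, and among the rows only [(1)] does.

Conversely, [s_k] gives ordinal 1 to the hook [(k, 1, ..., 1)] of [k] rows
(to [(2)] if [k = 1]), because all its nonempty options have ordinal [k]. *)

Local Open Scope ring_scope.

(** * Hooks and their options *)

Lemma hook_subproof (p q : nat) :
  sorted geq (p.+1 :: nseq q 1%N) && (0%N \notin p.+1 :: nseq q 1%N).
Proof.
rewrite /= inE mem_nseq andbF andbT (path_sortedE geq_trans).
apply/andP; split; first by apply/allP => y /nseqP[-> _].
by elim: q => // -[|q] IH.
Qed.

(* [p] and [q] are the lengths of the arms of the hook without its corner. *)
Definition hook (p q : nat) : position := Position (hook_subproof p q).

Lemma hook_neq0 (p q : nat) : hook p q != pos0.
Proof. by []. Qed.

Lemma trim_pos (P : position) : trim P = P.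
Proof.
case: P => s /= /andP[_ s0]; apply/all_filterP/allP => y ys.
by rewrite lt0n; apply: contraNneq s0 => <-.
Qed.

Lemma chomp_hook_arm (p q a : nat) : (0 < a)%N ->
  chomp (hook p q) 0 a = hook (minn p a.-1) q.
Proof.
case: a => // a _; apply: val_inj => /=.
rewrite /chomp_seq /= map_nseq !minnSS min0n /=; congr cons.
by rewrite /trim filter_nseq mul1n.
Qed.

Lemma chomp_hook_leg (p q x : nat) : (x <= q)%N ->
  chomp (hook p q) x.+1 0 = hook p x.
Proof.
move=> xq; apply: val_inj => /=; rewrite /chomp_seq /=; congr cons.
rewrite take_nseq // drop_nseq map_nseq minn0 /trim filter_cat.
by rewrite !filter_nseq /= cats0 mul1n.
Qed.

Lemma chomp_corner (P : position) : chomp P 0 0 = pos0.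
Proof.
apply: val_inj; rewrite /= /chomp_seq take0 drop0 /=.
by elim: (P : seq nat) => //= y s IH; rewrite minn0.
Qed.

Lemma move_hook_arm (p p' q : nat) :
  (p' < p)%N -> move (hook p q) (hook p' q).
Proof.
move=> pp; exists 0%N, p'.+1; split=> //.
  by rewrite chomp_hook_arm //= (minn_idPr (ltnW pp)).
by move=> [E]; rewrite E ltnn in pp.
Qed.

Lemma move_hook_leg (p q q' : nat) :
  (q' < q)%N -> move (hook p q) (hook p q').
Proof.
move=> qq; exists q'.+1, 0%N; split.
- by rewrite /= size_nseq ltnS.
- by rewrite chomp_hook_leg // ltnW.
- move=> /(congr1 (size \o parts)) /=; rewrite !size_nseq => -[E].
  by rewrite E ltnn in qq.
Qed.

(** A cut from the first row at positive height leaves the leg intact, and a cut inside the leg,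
    whose rows have length 1, changes something only at height 0. *)
Lemma move_hookP (p q : nat) (Q : position) : move (hook p q) Q ->
  [\/ Q = pos0, exists2 p', (p' < p)%N & Q = hook p' q
    | exists2 q', (q' < q)%N & Q = hook p q'].
Proof.
case=> -[|x] [a [xq -> neq]].
  case: (posnP a) => [->|a0]; first by rewrite chomp_corner; constructor 1.
  move: neq; rewrite chomp_hook_arm // => neq; constructor 2.
  exists (minn p a.-1) => //; rewrite ltnNge; apply/negP => le.
  by apply: neq; congr hook; apply/eqP; rewrite eqn_leq geq_minl.
rewrite /= size_nseq ltnS in xq.
case: (posnP a) neq => [->|a0] neq.
  by constructor 3; exists x; rewrite ?chomp_hook_leg // ltnW.
case: neq; apply: val_inj; rewrite -[RHS]trim_pos /=; congr (_ :: trim _).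
rewrite take_nseq ?(ltnW xq) // drop_nseq map_nseq (minn_idPl a0).
by rewrite -nseqD subnKC // ltnW.
Qed.

Lemma move_pos0 (P : position) : P != pos0 -> move P pos0.
Proof. by move=> /pos0_in_Mov /MovP. Qed.

(** * The initial rise of the payoffs *)

Section Rule.
Variables (R : realType) (f : rule R).

Lemma size_rule_gt0 : (0 < size f)%N.
Proof. by case: f => s /= /andP[]. Qed.

Lemma score_lt (i : nat) : (i < size f)%N -> score f i = f`_i.
Proof. by rewrite /score => ->. Qed.

Lemma score_ge (i : nat) : (size f <= i)%N -> score f i = f`_0.
Proof. by rewrite /score leqNgt => /negPf ->. Qed.

Lemma s_pos0 : s_ f pos0 = f`_0.
Proof. by rewrite /s_ ord_pos0 score_lt // size_rule_gt0. Qed.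

Definition nondecreasing_below (k : nat) : Prop :=
  forall i j, (i <= j < k)%N -> f`_i <= f`_j.

(** The least [k] at which the payoffs end or drop works: ordinal [k] scores alpha_1 in the first
    case, by the wrap-around, and alpha_(k+1) in the second. *)
Lemma ex_increasing_prefix : exists k,
  [/\ (0 < k <= size f)%N, nondecreasing_below k & score f k <= f`_k.-1].
Proof.
pose A k := (0 < k)%N && ((size f <= k)%N || (f`_k < f`_k.-1)).
have exA : exists k, A k by exists (size f); rewrite /A leqnn size_rule_gt0.
case: (ex_minnP exA) => k /andP[k0 Ak] minA.
have ksz : (k <= size f)%N by apply: minA; rewrite /A leqnn size_rule_gt0.
have mono : nondecreasing_below k.
  move=> i j; elim: j => [|j IH] /andP[].
    by rewrite leqn0 => /eqP ->.
  rewrite leq_eqVlt => /predU1P[-> //|ij] jk.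
  apply: le_trans (IH _) _; first by rewrite -ltnS ij ltnW.
  case: leP => // lt; suff /minA : A j.+1 by rewrite leqNgt jk.
  by rewrite /A lt orbT.
exists k; split=> //; first by rewrite k0.
case: (leqP (size f) k) Ak => [szk _|ksz' /= /ltW]; last by rewrite score_lt.
by rewrite score_ge //; apply: mono; rewrite /= prednK.
Qed.

End Rule.

(** * Ordinals determined by the initial rise *)

Section Prefix.
Variables (R : realType) (f : rule R) (k : nat).
Hypotheses (k0 : (0 < k <= size f)%N) (mono : nondecreasing_below f k).

(** Induction on the volume. Ordinals below [k] are ranked alike by both rules, and an option of
    ordinal [k] never beats the empty position under either. *)
Lemma isomorphic_std (k_gt0 : (0 < k)%N) :
  score f k <= f`_0 -> isomorphic f (std_rule R k_gt0).
Proof.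
move=> sk; have /andP[_ ksz] := k0; set g := std_rule R k_gt0.
have gsz : size g = k by rewrite size_map size_iota.
have gnth i : (i < k)%N -> g`_i = i%:R.
  by move=> ik; rewrite (nth_map 0%N) ?size_iota // nth_iota.
move=> P; have [m] := ubnP (volume P).
elim: m P => // m IH P Pm /eqP P0.
have IHQ Q : move P Q -> ord f Q = ord g Q /\ (ord g Q <= k)%N.
  move=> PQ; case: (eqVneq Q pos0) => [->|Q0]; first by rewrite !ord_pos0.
  split; last by have /andP[_] := ord_bounds g Q0; rewrite gsz.
  by apply: IH; [apply: leq_trans (volume_move PQ) _ | apply/eqP].
have [i gi] : exists i, ord g P = i.+1.
  by exists (ord g P).-1; rewrite prednK //; have /andP[] := ord_bounds g P0.
rewrite gi; have /(ord_spec _ _ P0)[ik [Q PQ giQ] maxg] := gi.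
rewrite gsz in ik; rewrite gnth // in giQ maxg.
apply/(ord_spec _ _ P0); split; first exact: leq_trans ksz.
  have [fgQ] := IHQ Q PQ; rewrite leq_eqVlt => /predU1P[gQk|gQk].
    (* The best option for [g] has ordinal [k], so [i] is 0 and the empty position can replace it
       under [f]. *)
    move: giQ; rewrite {1}/s_ gQk score_ge ?gsz // gnth // => /eqP.
    rewrite eqr_nat => /eqP ->.
    by exists pos0; [apply: move_pos0 | rewrite s_pos0].
  move: giQ; rewrite /s_ score_lt ?gsz // gnth // => /eqP.
  rewrite eqr_nat => /eqP ->; exists Q => //.
  by rewrite /s_ fgQ score_lt // (leq_trans gQk).
move=> T PT; have [fgT] := IHQ T PT; rewrite leq_eqVlt /s_ fgT.
case/predU1P=> [->|gTk]; first exact: le_trans sk (mono _).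
move: (maxg T PT); rewrite /s_ score_lt ?gsz // gnth // ler_nat => ij.
by rewrite score_lt ?(leq_trans gTk) // mono // ij.
Qed.

Hypothesis sk : score f k <= f`_k.-1.

(** As payoffs rise up to entry [k.-1], an option with [minn (p + q) k.-1] cells is best. The bound
    on [minn p q] makes one reachable by shortening a single arm. *)
Lemma ord_hook (p q : nat) : (minn p q < k.-1)%N ->
  ord f (hook p q) = minn (p + q).+1 k.
Proof.
have /andP[k_gt0 ksz] := k0.
have [m] := ubnP (p + q); elim: m p q => // m IH p q pqm pqk.
pose t := minn (p + q) k.-1.
have -> : minn (p + q).+1 k = t.+1 by rewrite /t; lia.
have tk : (t < k)%N by rewrite /t; lia.
have bound r : (r < p + q)%N -> score f (minn r.+1 k) <= f`_t.
  move=> rpq; case: (ltnP r.+1 k) => rk.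
    rewrite score_lt ?(leq_trans rk) //.
    by apply: mono; rewrite /t; lia.
  (* Here [p + q] is at least [k], so [t] is [k.-1]. *)
  apply: le_trans sk _; apply: mono; rewrite /t; lia.
have attained p' q' : (p' + q').+1 = t -> (minn p' q' < k.-1)%N ->
    f`_t = s_ f (hook p' q').
  move=> pqt pqk'; rewrite /s_ IH //; last by rewrite /t in pqt; lia.
  by rewrite pqt (minn_idPl (ltnW tk)) score_lt // (leq_trans tk).
apply/(ord_spec _ _ (hook_neq0 p q)); split; first exact: leq_trans ksz.
  case: (posnP t) => [t0|t0].
    by exists pos0; [apply: move_pos0; apply: hook_neq0 | rewrite t0 s_pos0].
  (* An arm shorter than [t] is kept, and the other is cut so that [t] cells remain. If both had
     length at least [t > 0], then [t] would be [k.-1], against [pqk]. *)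
  case: (ltnP p t) => pt.
    exists (hook p (t.-1 - p)); last by apply: attained; rewrite /t in t0 pt *; lia.
    by apply: move_hook_leg; rewrite /t in t0 pt *; lia.
  case: (ltnP q t) => qt.
    exists (hook (t.-1 - q) q); last by apply: attained; rewrite /t in t0 qt *; lia.
    by apply: move_hook_arm; rewrite /t in t0 qt *; lia.
  by rewrite /t in t0 pt qt; lia.
move=> Q /move_hookP[->|[p' pp ->]|[q' qq ->]].
- by rewrite s_pos0; apply: mono.
- by rewrite /s_ IH; [apply: bound|..]; lia.
- by rewrite /s_ IH; [apply: bound|..]; lia.
Qed.

Lemma ord_eq1_pos1 (P : position) : f`_0 < score f k -> P != pos0 ->
  ord f P = 1%N <-> P = pos1.
Proof.
have /andP[k_gt0 ksz] := k0; move=> gt0 P0.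
(* For [k = 1], [sk] would contradict [gt0]. *)
have k1 : (1 < k)%N.
  case: k k_gt0 sk gt0 => [|[|?]] // _ /le_lt_trans /[apply].
  by rewrite ltxx.
have f_uniq : uniq f by case: (f) => s /= /andP[].
have ord_row p : ord f (hook p 0) = minn p.+1 k.
  by rewrite ord_hook ?addn0 // minn0; lia.
have score_row p : f`_0 < s_ f (hook p 0).
  rewrite /s_ ord_row; case: (ltnP p.+1 k) => pk //.
  rewrite score_lt ?(leq_trans pk) //.
  (* Strictness comes from the payoffs being distinct. *)
  by rewrite lt_neqAle nth_uniq ?size_rule_gt0 ?(leq_trans pk) //= mono.
split=> [P1|->]; last first.
  have -> : pos1 = hook 0 0 by apply: val_inj.
  by rewrite ord_row (minn_idPl k_gt0).
case: P P0 P1 => -[|[|a] s] sP P0 P1.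
- by case/eqP: P0; apply: val_inj.
- by have /andP[_] := sP.
case: s sP P0 P1 => [|b s] sP P0 P1.
  have PE : Position sP = hook a 0 by apply: val_inj.
  move: P1; rewrite PE ord_row => a1; apply: val_inj => /=.
  by congr (_ :: _); lia.
have row : hook a 0 = chomp (Position sP) 1 0.
  apply: val_inj => /=; rewrite /chomp_seq /=.
  by congr cons; elim: (s) => //= y r ->.
have PQ : move (Position sP) (hook a 0) by exists 1%N, 0%N.
have /(ord_spec _ _ P0)[_ _ /(_ _ PQ)] := P1.
by rewrite leNgt score_row.
Qed.

End Prefix.

Lemma ex_std_ord_eq1 (R : realType) (k : nat) (k_gt0 : (0 < k)%N) :
  exists P, [/\ P <> pos0, P <> pos1 & ord (std_rule R k_gt0) P = 1%N].
Proof.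
set g := std_rule R k_gt0.
have gsz : size g = k by rewrite size_map size_iota.
have gnth i : (i < k)%N -> g`_i = i%:R.
  by move=> ik; rewrite (nth_map 0%N) ?size_iota // nth_iota.
case: (ltnP 1 k) => k1; last first.
  exists (hook 1 0); split=> //.
  by have := ord_bounds g (hook_neq0 1 0); rewrite gsz; lia.
have mono : nondecreasing_below g k.
  move=> i j /andP[ij jk]; rewrite !gnth ?ler_nat //.
  exact: leq_ltn_trans ij jk.
have k0 : (0 < k <= size g)%N by rewrite gsz k_gt0 /=.
have sk : score g k <= g`_k.-1.
  by rewrite score_ge ?gsz // mono // ltn_predL.
have hookk p q : (minn p q < k.-1)%N -> (k <= (p + q).+1)%N ->
    s_ g (hook p q) = g`_0.
  move=> pq kpq; rewrite /s_ (ord_hook k0 mono sk) //.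
  by rewrite (minn_idPr kpq) score_ge ?gsz.
exists (hook k.-1 k.-1); split=> //.
  by move=> /(congr1 (size \o parts)) /=; rewrite size_nseq; lia.
apply/(ord_spec _ _ (hook_neq0 _ _)); split; first by rewrite gsz.
  by exists pos0; [apply: move_pos0; apply: hook_neq0 | rewrite s_pos0].
move=> Q /move_hookP[->|[p' pp ->]|[q' qq ->]]; first by rewrite s_pos0.
- by rewrite hookk //; lia.
- by rewrite hookk //; lia.
Qed.

Theorem theorem3p12 (R : realType) (f : rule R) :
  ~ standard f <->
  (forall P : position, P <> pos0 -> (ord f P = 1%N <-> P = pos1)).
Proof.
split=> [nstd P /eqP P0|ord1 [k [k_gt0 iso]]].
  have [k [k0 mono sk]] := @ex_increasing_prefix R f.
  case: (ltP f`_0 (score f k)) => [gt0|le0].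
    exact: (@ord_eq1_pos1 R f k).
  have /andP[k_gt0 _] := k0.
  by case: nstd; exists k, k_gt0; apply: isomorphic_std.
have [P [P0 P1 Pord]] := @ex_std_ord_eq1 R k k_gt0.
by apply: P1; apply/(ord1 P P0); rewrite iso.
Qed.
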